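(* Let $V_1,\ldots,V_k$ be sets and $R\subseteq V_1\times\cdots\times V_k$ a $d$-stable relation. For each $i$ let $\mathcal B_i$ be a field on $V_i$ containing all fibres $R_b$, $b\in V_{i^\circ}$, and let $\mu_i$ be a measure on $\mathcal B_i$; let $\mu=\mu_1\ltimes\cdots\ltimes\mu_k$. Let $0<\varepsilon<\frac1{2^d}$. Then there is an $R$-definable rectangular partition $\vec{\mathcal P}$ of $V_1\times\cdots\times V_k$ which is $\varepsilon$-regular with $0$-$1$-densities with exceptional set $\Sigma=\emptyset$, i.e. for every cell $X=X_1\times\cdots\times X_k$ of $\vec{\mathcal P}$, either $\mu(Y_1\times\cdots\times Y_k)-\mu(R\cap(Y_1\times\cdots\times Y_k))<\varepsilon\mu(X)$ for all $Y_i\in\mathcal B_i$ with $Y_i\subseteq X_i$, or $\mu(R\cap(Y_1\times\cdots\times Y_k))<\varepsilon\mu(X)$ for all $Y_i\in\mathcal B_i$ with $Y_i\subseteq X_i$; moreover $\|\vec{\mathcal P}\|$ is bounded by a polynomial of degree $d+1$ in $\frac1\varepsilon$ (depending only on $d$ and $k$).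
   Context: Notation: $[k]=\{1,\ldots,k\}$, $I^\circ=[k]\setminus I$, $i^\circ=[k]\setminus\{i\}$, $V_I=\prod_{i\in I}V_i$; for $b\in V_{I^\circ}$, $R_b=\{a\in V_I:(a,b)\in R\}$. A subset of $V_i$ is $R$-definable if it is a finite Boolean combination of fibres $R_b$, $b\in V_{i^\circ}$. Stability: a binary relation $R\subseteq V\times W$ is $d$-stable if there is no tree $(b_\eta:\eta\in2^{<d})$ of elements of $W$ such that for every $\eta\in2^d$ there is $a_\eta\in V$ with $a_\eta\in R_{b_\nu}\iff\nu^\frown1\trianglelefteq\eta$ for all $\nu\in 2^{<d}$ with $\nu\triangleleft\eta$ ($\trianglelefteq$ the initial-segment order). $R\subseteq V_1\times\cdots\times V_k$ is $d$-stable if for every $I\subseteq[k]$, $R$ viewed as a binary relation on $V_I\times V_{I^\circ}$ is $d$-stable. A field is a Boolean algebra of subsets; a measure is a finitely additive probability measure. Since $R$ is stable every measure on $\mathcal B_i$ is fap on $R$ (finitely approximable by averages over finite multisets on Boolean combinations of fibres), so the product $\mu_1\ltimes\cdots\ltimes\mu_k=(\mu_1\ltimes\cdots\ltimes\mu_{k-1})\ltimes\mu_k$ is defined, where $\mu\ltimes\nu$ is the unique finitely additive probability measure on the field generated by boxes of measurable sets and $R$-definable sets, extending the product on boxes and satisfying $(\mu\ltimes\nu)(D\cap(A\times B))=\int_B\mu(A\cap D_y)\,d\nu(y)$ for $R$-definable $D$. A rectangular partition $\vec{\mathcal P}=(\mathcal P_1,\ldots,\mathcal P_k)$ consists of finite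 partitions $\mathcal P_i$ of $V_i$; it is $R$-definable if all parts are $R$-definable; $\|\vec{\mathcal P}\|=\max_i|\mathcal P_i|$; cells are $X_1\times\cdots\times X_k$ with $X_i\in\mathcal P_i$. *)

(* Defs.v *)
From HB Require Import structures.
From mathcomp Require Export all_boot all_order all_algebra finmap.
From mathcomp Require Export all_classical all_reals.
From mathcomp Require Export measurable_structure numfun.
#[export] Set Implicit Arguments.
#[export] Unset Strict Implicit.
#[export] Unset Printing Implicit Defensive.
Export Order.TTheory GRing.Theory Num.Theory.
Local Open Scope classical_set_scope.
Local Open Scope ring_scope.

(** * Fields of sets, finitely additive measures, integration *)

(* [algebraOfSetsType] is not used because the carrier may be an arbitrary
   type, and because the fields on partial products are defined by recursion. *)
Definition set_field (T : Type) (F : set (set T)) : Prop :=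
  setring F /\ F setT.

Definition gen_field (T : Type) (G : set (set T)) : set (set T) :=
  smallest (@set_field T) G.

(* Values of [m] outside [F] are irrelevant. *)
Definition fa_probability (R : realType) (T : Type)
    (F : set (set T)) (m : set T -> R) : Prop :=
  [/\ forall A, F A -> 0 <= m A,
      m setT = 1 &
      forall A B, F A -> F B -> A `&` B = set0 -> m (A `|` B) = m A + m B].

(* [f] is a uniform limit of F-simple functions (finite linear combinations of
   indicators of sets of F) whose integrals tend to [r]; [r] is then unique. *)
Definition is_fa_integral (R : realType) (T : Type)
    (F : set (set T)) (m : set T -> R) (f : T -> R) (r : R) : Prop :=
  forall e : R, 0 < e -> exists (n : nat) (c : 'I_n -> R) (S : 'I_n -> set T),
    [/\ forall j, F (S j),
        forall x, `|f x - \sum_(j < n) c j * \1_(S j) x| <= e &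
        `|r - \sum_(j < n) c j * m (S j)| <= e].

(** * Binary stability *)

(* Trees of height d: nodes are the 0-1 words of length < d, leaves the words
   of length d. *)
Definition binary_stable (d : nat) (V W : Type) (E : V -> W -> Prop) : Prop :=
  ~ exists b : (forall nu : seq bool, (size nu < d)%N -> W),
      forall eta : d.-tuple bool, exists a : V,
        forall (nu : seq bool) (h : (size nu < d)%N), prefix nu eta ->
          (E a (b nu h) <-> prefix (rcons nu true) eta).

(** * The product of [mu] and [nu] relative to definable sets

   Here X plays the role of T * U through [split], and [D] is the collection
   of definable subsets of X. *)

Section Ltimes.
Variables (R : realType) (X T U : Type) (split : X -> T * U).
Variables (FT : set (set T)) (FU : set (set U)) (D : set (set X)).

Definition rectangle (A : set T) (B : set U) : set X :=
  split @^-1` (A `*` B).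

Definition section_at (E : set X) (y : U) : set T :=
  [set t | exists2 x, E x & split x = (t, y)].

Definition ltimes_field : set (set X) :=
  gen_field ([set E | exists A B, [/\ FT A, FU B & E = rectangle A B]] `|` D).

Definition is_ltimes (mu : set T -> R) (nu : set U -> R) (m : set X -> R) :
    Prop :=
  [/\ fa_probability ltimes_field m,
      forall A B, FT A -> FU B -> m (rectangle A B) = mu A * nu B &
      forall E A B, D E -> FT A -> FU B ->
        is_fa_integral FU nu
          (fun y => mu (A `&` section_at E y) * \1_B y)
          (m (E `&` rectangle A B))].

End Ltimes.

(** * Relations on V_1 x ... x V_k *)

Section Relation.
Variables (k : nat) (V : 'I_k -> Type).

Definition subprod (I : {set 'I_k}) : Type := forall i : 'I_k, i \in I -> V i.

Definition proj (I : {set 'I_k}) (x : forall i, V i) : subprod I :=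
  fun i _ => x i.
Arguments proj I x : clear implicits.

Definition box (Y : forall i, set (V i)) : set (forall i, V i) :=
  [set x | forall i, Y i (x i)].

Variable Q : set (forall i, V i).

(* For a in V_I and b in V_(~: I), the point (a, b) is the unique x with
   projections a and b. *)
Definition fibre (I : {set 'I_k}) (b : subprod (~: I)) : set (subprod I) :=
  [set a | exists x, [/\ Q x, proj I x = a & proj (~: I) x = b]].

Definition fibre1 (i : 'I_k) (b : subprod (~: [set i])) : set (V i) :=
  [set a | exists x, [/\ Q x, x i = a & proj (~: [set i]) x = b]].

Definition stable (d : nat) : Prop :=
  forall I : {set 'I_k},
    binary_stable d (fun (a : subprod I) (b : subprod (~: I)) => fibre b a).

(* Finite Boolean combinations of fibres = the field they generate. *)
Definition definable (I : {set 'I_k}) : set (set (subprod I)) :=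
  gen_field (range (@fibre I)).

Definition definable1 (i : 'I_k) : set (set (V i)) :=
  gen_field (range (@fibre1 i)).

(** The iterated product (mu_1 ltimes ... ) ltimes mu_k. *)

Definition below (m : nat) : {set 'I_k} := [set i : 'I_k | (i < m)%N].

Lemma below_last (i : 'I_k) : i \in below i.+1.
Proof. by rewrite inE. Qed.

Lemma below_widen (i j : 'I_k) : j \in below i -> j \in below i.+1.
Proof. by rewrite !inE => /ltnW. Qed.

Definition split_last (i : 'I_k) (x : subprod (below i.+1)) :
    subprod (below i) * V i :=
  (fun j hj => x j (below_widen hj), x i (below_last i)).

Variable B : forall i, set (set (V i)).

Fixpoint prod_field (m : nat) : (m <= k)%N -> set (set (subprod (below m))) :=
  match m with
  | 0 => fun _ => setT
  | m'.+1 => fun h =>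
      ltimes_field (@split_last (Ordinal h)) (prod_field (ltnW h))
        (@B (Ordinal h)) (@definable (below m'.+1))
  end.

Variables (R : realType) (mu : forall i, set (V i) -> R).

(* The recursion starts from the probability measure on the one-point empty
   product, so that the product of a single mu_1 is mu_1 itself. *)
Fixpoint is_partial_product (m : nat) :
    (m <= k)%N -> (set (subprod (below m)) -> R) -> Prop :=
  match m with
  | 0 => fun _ M => fa_probability setT M
  | m'.+1 => fun h M =>
      exists2 M', is_partial_product (ltnW h) M' &
        is_ltimes (@split_last (Ordinal h)) (prod_field (ltnW h))
          (@B (Ordinal h)) (@definable (below m'.+1)) M' (@mu (Ordinal h)) M
  end.

(* [proj (below k)] is a bijection from the full product. *)
Definition is_product (M : set (forall i, V i) -> R) : Prop :=
  is_partial_product (leqnn k) (fun A => M (proj (below k) @^-1` A)).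

(** * Rectangular partitions *)

Definition rect_partition (P : forall i, set (set (V i))) : Prop :=
  forall i, finite_set (P i) /\ partition (P i) id [set: V i].

Definition rect_definable (P : forall i, set (set (V i))) : Prop :=
  forall i, P i `<=` @definable1 i.

Definition rect_norm (P : forall i, set (set (V i))) : nat :=
  (\max_(i < k) #|` fset_set (P i)|)%N.

End Relation.

Arguments proj {k V} I x.

(* Main.v *)
Require Import Defs.
From mathcomp Require Import lra ring zify.
Local Open Scope classical_set_scope.
Local Open Scope ring_scope.

(** Call a set [X] of V_i [e]-good if every fibre contains or misses all but an
    [e]-fraction of [X]. Repeatedly splitting a set that is not good by a
    fibre would build a binary tree of height d, so by stability every set [X]
    of positive measure contains a good definable set of measure at least
    [e ^ d * mu X]. Peeling off good sets leaves a remainder that decreases by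
    the factor [1 - e ^ d] each time; after O(e ^ -(d+1)) steps it is so small
    that it can be absorbed by the first piece. In particular every part has
    positive measure, which the strict inequalities require.

    A cell with good sides has density near 0 or 1, by induction on the number
    of factors. With A the product of the first sides and B the next one, the
    fibres over the points of B have density near 0 or 1 in A. If both kinds
    of points were frequent in B, sampling alternately points a of A and pairs
    of points of B, one of each kind, that agree with the behaviour of a on
    most of B, one would get a half graph of length 2 ^ d, against stability.
    This replaces any exchange of the order of integration. *)

(** * Trees and half graphs *)

(** Recursive form of the trees in [binary_stable], with all leaves witnessed inside [P]. It suits
    arguments that split a set by one fibre at a time. *)
Fixpoint split_tree (V W : Type) (E : V -> W -> Prop) (d : nat) (P : set V) :
    Prop :=
  match d with
  | 0 => P !=set0
  | d'.+1 => exists b, split_tree E d' (P `&` E ^~ b) /\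
                       split_tree E d' (P `\` E ^~ b)
  end.

Lemma split_tree_sub (V W : Type) (E : V -> W -> Prop) (d : nat) (P P' : set V) :
  P `<=` P' -> split_tree E d P -> split_tree E d P'.
Proof.
elim: d P P' => [|d IHd] P P' PP' /=; first by case=> a Pa; exists a; exact: PP'.
move=> [b [Hl Hr]]; exists b; split; first by apply: IHd Hl; exact: setSI.
by apply: IHd Hr; exact: setSD.
Qed.

(** A word is read from the root: its first letter selects the subtree that labels the remaining
    letters. The default [w] labels the words that are too long to be nodes, which for [d] equal to
    0 are all words. *)
Lemma split_tree_nodes (V W : Type) (E : V -> W -> Prop) (w : W) (d : nat)
    (P : set V) :
  split_tree E d P ->
  exists b : seq bool -> W, forall eta : seq bool, size eta = d ->
    exists2 a, P a & forall nu : seq bool, (size nu < d)%N -> prefix nu eta ->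
      (E a (b nu) <-> prefix (rcons nu true) eta).
Proof.
elim: d P => [|d IHd] P /=; first by case=> a Pa; exists (fun=> w) => eta _; exists a.
move=> [b0 [/IHd[b1 H1] /IHd[b2 H2]]].
exists (fun nu => if nu is x :: nu' then (if x then b1 nu' else b2 nu') else b0).
case=> [//|[] eta] [size_eta].
  have [a [Pa Ea] Ha] := H1 _ size_eta; exists a => //.
  case=> [|[] nu] //= size_nu; rewrite ?prefix0s ?eqxx //=.
  by move=> pre; apply: Ha.
have [a [Pa Ea] Ha] := H2 _ size_eta; exists a => //.
case=> [|[] nu] //= size_nu; rewrite ?prefix0s ?eqxx //=.
by move=> pre; apply: Ha.
Qed.

Lemma split_tree_unstable (V W V' W' : Type) (E : V -> W -> Prop)
    (E' : V' -> W' -> Prop) (f : V -> V') (g : W -> W') (w : W) (d : nat)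
    (P : set V) :
  (forall a b, E' (f a) (g b) <-> E a b) ->
  split_tree E d P -> ~ binary_stable d E'.
Proof.
move=> EE' /(split_tree_nodes w)[b Hb] []; exists (fun nu _ => g (b nu)) => eta.
have [a _ Ha] := Hb eta (size_tuple eta).
exists (f a) => nu size_nu pre.
by split=> [/EE' /(Ha _ size_nu pre)//|/(Ha _ size_nu pre) /EE'].
Qed.

(* The sequence is ordered from the newest pair to the oldest one: [e u.1 t.2]
   is [v] exactly when [t] is newer than [u]. *)
Lemma half_graph_split_tree (T U : Type) (e : T -> U -> bool) (v : bool)
    (d : nat) (s : seq (T * U)) (P : set U) :
  (2 ^ d <= size s)%N ->
  all (fun t => e t.1 t.2 == ~~ v) s ->
  pairwise (fun t u => (e u.1 t.2 == v) && (e t.1 u.2 == ~~ v)) s ->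
  all (fun t => `[< P t.2 >]) s ->
  split_tree (fun y a => e a y) d P.
Proof.
elim: d s P => [|d IHd] s P.
  by case: s => [//|t s] _ _ _ /= /andP[/asboolP Pt _]; exists t.2.
rewrite expnS mul2n -addnn => size_s.
rewrite -(cat_take_drop (2 ^ d) s) !all_cat pairwise_cat.
have size1 : size (take (2 ^ d) s) = (2 ^ d)%N.
  by rewrite size_takel// (leq_trans _ size_s)// leq_addr.
have size2 : (2 ^ d <= size (drop (2 ^ d) s))%N by rewrite size_drop; lia.
move: (take _ _) (drop _ _) size1 size2 => s1 s2 size1 size2 {size_s s}.
move=> /andP[self1 self2] /and3P[rel12 rel1 rel2] /andP[P1 P2].
(* [u] is the newest pair of the older half. The point [u.1] splits [P]: it has value [v] on all
   points of the newer half, and [~~ v] on its own point and on all older ones. *)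
case: s2 size2 self2 rel12 rel2 P2 => [|u s2] size2 self2 rel12 rel2 P2.
  by move: size2; rewrite leqn0 expn_eq0.
have new : all (fun t => `[< (P `&` [set y | e u.1 y = v]) t.2 >]) s1.
  move: rel12; rewrite allrel_consr => /andP[rel12 _].
  have : all (predI (fun t => `[< P t.2 >])
      (fun t => (e u.1 t.2 == v) && (e t.1 u.2 == ~~ v))) s1.
    by rewrite all_predI P1.
  by apply: sub_all => t /= /andP[/asboolP Pt /andP[/eqP et _]]; exact/asboolP.
have old : all (fun t => `[< (P `&` [set y | e u.1 y = ~~ v]) t.2 >]) (u :: s2).
  have : all (predI (fun t => `[< P t.2 >])
      (fun t => e u.1 t.2 == ~~ v)) (u :: s2).
    rewrite all_predI P2 /=; move: self2 rel2 => /= /andP[-> _] /andP[rel2 _].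
    by apply: sub_all rel2 => t /andP[].
  by apply: sub_all => t /= /andP[/asboolP Pt /eqP et]; exact/asboolP.
have tree1 := IHd s1 _ (eq_leq (esym size1)) self1 rel1 new.
have tree2 := IHd (u :: s2) _ size2 self2 rel2 old.
exists u.1; case: v {self1 self2 rel12 rel1 rel2 new old} IHd tree1 tree2 => _ t1 t2.
  split; first exact: t1.
  by apply: split_tree_sub t2 => y [Py /= ey]; split=> //=; rewrite ey.
split; first exact: t2.
by apply: split_tree_sub t1 => y [Py /= ey]; split=> //=; rewrite ey.
Qed.

(** * Finitely additive measures *)

Section SetField.
Context (T : Type) (F : set (set T)).
Hypothesis fieldF : set_field F.

Lemma set_field0 : F set0. Proof. by case: fieldF => -[]. Qed.

Lemma set_fieldT : F setT. Proof. by case: fieldF. Qed.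

Lemma set_fieldU A B : F A -> F B -> F (A `|` B).
Proof. by case: fieldF => -[_ + _] _; apply. Qed.

Lemma set_fieldD A B : F A -> F B -> F (A `\` B).
Proof. by case: fieldF => -[_ _ +] _; apply. Qed.

Lemma set_fieldI A B : F A -> F B -> F (A `&` B).
Proof. by move=> FA FB; rewrite -setDD; do 2 apply: set_fieldD => //. Qed.

Context (R : realType) (m : set T -> R).
Hypothesis probm : fa_probability F m.

Lemma fa_ge0 A : F A -> 0 <= m A. Proof. by case: probm => + _ _; apply. Qed.

Lemma fa_setT : m setT = 1. Proof. by case: probm. Qed.

Lemma fa_setU A B : F A -> F B -> A `&` B = set0 -> m (A `|` B) = m A + m B.
Proof. by case: probm => _ _; apply. Qed.

Lemma fa_set0 : m set0 = 0.
Proof.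
have := fa_setU set_field0 set_field0 (setI0 _).
by rewrite setU0; lra.
Qed.

Lemma fa_split A B : F A -> F B -> m A = m (A `&` B) + m (A `\` B).
Proof.
move=> FA FB; rewrite -[in LHS](setUIDK A B) fa_setU//.
- exact: set_fieldI.
- exact: set_fieldD.
- by rewrite setDE setIACA setICr setI0.
Qed.

Lemma fa_mono A B : F A -> F B -> A `<=` B -> m A <= m B.
Proof.
move=> FA FB AB; rewrite (fa_split FB FA) (setIidr AB) lerDl.
by apply: fa_ge0; exact: set_fieldD.
Qed.

Lemma fa_setUle A B : F A -> F B -> m (A `|` B) <= m A + m B.
Proof.
move=> FA FB; rewrite (fa_split (set_fieldU FA FB) FA) setUK.
rewrite lerD2l; apply: fa_mono => //; last by rewrite setDUl setDv set0U => x [].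
by apply: set_fieldD => //; exact: set_fieldU.
Qed.

Lemma fa_nonempty A : 0 < m A -> A !=set0.
Proof.
by move=> mA; apply/set0P/eqP => A0; move: mA; rewrite A0 fa_set0 ltxx.
Qed.

(** On [S ord_max] the last term translates [L] by its coefficient, and elsewhere it vanishes. This
    is why the induction runs over arbitrary [L]. *)
Lemma simple_level_field n (c : 'I_n -> R) (S : 'I_n -> set T) (L : set R) :
  (forall j, F (S j)) -> F [set x | L (\sum_(j < n) c j * \1_(S j) x)].
Proof.
elim: n c S L => [|n IHn] c S L FS.
  case: (pselect (L 0)) => L0.
    rewrite (_ : [set x | _] = setT); first exact: set_fieldT.
    by apply/seteqP; split=> x //= _; rewrite big_ord0.
  rewrite (_ : [set x | _] = set0); first exact: set_field0.
  by apply/seteqP; split=> x //=; rewrite big_ord0.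
pose S' j := S (widen_ord (leqnSn n) j).
pose c' j := c (widen_ord (leqnSn n) j).
have FS' j : F (S' j) by exact: FS.
have F1 := IHn c' S' [set r | L (r + c ord_max)] FS'.
have F2 := IHn c' S' L FS'.
rewrite (_ : [set x | _] =
    S ord_max `&` [set x | L (\sum_(j < n) c' j * \1_(S' j) x + c ord_max)] `|`
    [set x | L (\sum_(j < n) c' j * \1_(S' j) x)] `\` S ord_max).
  by apply: set_fieldU; [exact: set_fieldI | exact: set_fieldD].
apply/seteqP; split=> x /=; rewrite big_ord_recr /= indicE.
  have [Sx|Sx] := pselect (S ord_max x).
    by rewrite (mem_set Sx) mulr1 => Lx; left.
  by rewrite (memNset Sx) mulr0 addr0 => Lx; right.
by move=> [[Sx Lx]|[Lx Sx]];
  rewrite ?(mem_set Sx) ?(memNset Sx) ?mulr1 ?mulr0 ?addr0.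
Qed.

(** The sets [S j] may overlap. Cutting [G] along the last one absorbs its coefficient into the
    constant [t] on one half, so the induction runs over all [t] and [G]. *)
Lemma simple_ge0 n (c : 'I_n -> R) (S : 'I_n -> set T) (t : R) (G : set T) :
  (forall j, F (S j)) -> F G ->
  (forall x, G x -> 0 <= t + \sum_(j < n) c j * \1_(S j) x) ->
  0 <= t * m G + \sum_(j < n) c j * m (S j `&` G).
Proof.
elim: n c S t G => [|n IHn] c S t G FS FG pos.
  rewrite big_ord0 addr0; have [->|/set0P[x Gx]] := eqVneq G set0.
    by rewrite fa_set0 mulr0.
  by apply: mulr_ge0; [have := pos x Gx; rewrite big_ord0 addr0 | exact: fa_ge0].
pose S' j := S (widen_ord (leqnSn n) j).
pose c' j := c (widen_ord (leqnSn n) j).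
have FS' j : F (S' j) by exact: FS.
have FGI : F (G `&` S ord_max) by exact: set_fieldI.
have FGD : F (G `\` S ord_max) by exact: set_fieldD.
have H1 : 0 <= (t + c ord_max) * m (G `&` S ord_max) +
    \sum_(j < n) c' j * m (S' j `&` (G `&` S ord_max)).
  apply: IHn => // x [Gx Sx].
  have := pos x Gx; rewrite big_ord_recr /= indicE (mem_set Sx) mulr1.
  by rewrite addrA (addrAC t).
have H2 : 0 <= t * m (G `\` S ord_max) +
    \sum_(j < n) c' j * m (S' j `&` (G `\` S ord_max)).
  apply: IHn => // x [Gx Sx].
  by have := pos x Gx; rewrite big_ord_recr /= indicE (memNset Sx) mulr0 addr0.
rewrite big_ord_recr /= (setIC (S ord_max)) (fa_split FG (FS ord_max)).
under eq_bigr => j _.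
  rewrite (fa_split (set_fieldI (FS' j) FG) (FS ord_max)) -setIA -setIDA mulrDr.
  over.
rewrite big_split /=.
set a := \sum_(i < n) _ in H1 *; set b := \sum_(i < n) _ in H2 *.
by move: (addr_ge0 H1 H2); lra.
Qed.

(** An approximating simple function is cut along [B1], [B2] and the rest. The uniform error costs
    [e / 2] over the whole space, and the error of the integral another [e / 2]. *)
Lemma fa_integral_le (f : T -> R) (r t1 t2 : R) (B1 B2 : set T) :
  F B1 -> F B2 -> B1 `&` B2 = set0 -> is_fa_integral F m f r ->
  (forall x, B1 x -> f x <= t1) -> (forall x, B2 x -> f x <= t2) ->
  (forall x, ~ (B1 `|` B2) x -> f x <= 0) ->
  r <= t1 * m B1 + t2 * m B2.
Proof.
move=> FB1 FB2 B12 intf f1 f2 f0.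
apply/ler_addgt0Pr => e e0.
have [n [c [S [FS fS rS]]]] := intf (e / 2) ltac:(lra).
have piece G t : F G -> (forall x, G x -> f x <= t) ->
    \sum_(j < n) c j * m (S j `&` G) <= (t + e / 2) * m G.
  move=> FG ft; rewrite -subr_ge0.
  rewrite -sumrN; under eq_bigr do rewrite -mulNr.
  apply: simple_ge0 => // x Gx; under eq_bigr do rewrite mulNr.
  rewrite sumrN; have := fS x; have := ft x Gx.
  by rewrite ler_distl => ? /andP[]; lra.
pose B3 := setT `\` (B1 `|` B2).
have FB12 : F (B1 `|` B2) by exact: set_fieldU.
have FB3 : F B3 by apply: set_fieldD => //; exact: set_fieldT.
have p1 := piece _ _ FB1 f1; have p2 := piece _ _ FB2 f2.
have p3 : \sum_(j < n) c j * m (S j `&` B3) <= (0 + e / 2) * m B3.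
  by apply: piece => // x [_]; exact: f0.
have : \sum_(j < n) c j * m (S j) = \sum_(j < n) c j * m (S j `&` B1) +
    \sum_(j < n) c j * m (S j `&` B2) + \sum_(j < n) c j * m (S j `&` B3).
  rewrite -!big_split /=; apply: eq_bigr => j _; rewrite -!mulrDr.
  rewrite (fa_split (FS j) FB12) setIUr fa_setU.
  - by rewrite /B3 setTD.
  - exact: set_fieldI.
  - exact: set_fieldI.
  - by rewrite setIACA B12 setI0.
have : m B1 + m B2 + m B3 = 1.
  by rewrite -fa_setT (fa_split set_fieldT FB12) setTI fa_setU.
move: rS; rewrite ler_distl => /andP[_].
by move: p1 p2 p3; rewrite !mulrDl; nra.
Qed.

Lemma fa_integralN (f : T -> R) (r : R) :
  is_fa_integral F m f r -> is_fa_integral F m (fun x => - f x) (- r).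
Proof.
move=> intf e /intf[n [c [S [FS fS rS]]]].
exists n, (fun j => - c j), S; split=> // [x|].
  by under eq_bigr do rewrite mulNr; rewrite sumrN -opprD normrN.
by under eq_bigr do rewrite mulNr; rewrite sumrN -opprD normrN.
Qed.

Lemma fa_integral_ge (f : T -> R) (r t1 t2 : R) (B1 B2 : set T) :
  F B1 -> F B2 -> B1 `&` B2 = set0 -> is_fa_integral F m f r ->
  (forall x, B1 x -> t1 <= f x) -> (forall x, B2 x -> t2 <= f x) ->
  (forall x, ~ (B1 `|` B2) x -> 0 <= f x) ->
  t1 * m B1 + t2 * m B2 <= r.
Proof.
move=> FB1 FB2 B12 /fa_integralN intf f1 f2 f0.
have /= := fa_integral_le (t1 := - t1) (t2 := - t2) FB1 FB2 B12 intf.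
rewrite !mulNr -opprD lerN2; apply=> x Bx; rewrite ?oppr_le0 ?lerN2; auto.
Qed.

(* The gap at [t] makes the level set of [f] a level set of an approximating
   simple function. *)
Lemma fa_integral_level_field (f : T -> R) (r t e : R) :
  is_fa_integral F m f r -> 0 < e ->
  (forall x, f x <= t - e \/ t + e <= f x) -> F [set x | t < f x].
Proof.
move=> intf e0 gap.
have [n [c [S [FS fS rS]]]] := intf (e / 2) ltac:(lra).
rewrite (_ : [set x | _] = [set x | t < \sum_(j < n) c j * \1_(S j) x]).
  exact: (simple_level_field c [set s | t < s] FS).
apply/seteqP; split=> x /=; have := fS x; rewrite ler_distl => /andP[];
  case: (gap x); lra.
Qed.

End SetField.

Lemma gen_field_set_field (T : Type) (G : set (set T)) : set_field (gen_field G).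
Proof.
split; last by move=> F [[]].
split=> [F [[[]]]//|A B FA FB F FG|A B FA FB F FG];
  have fF := FG.1.
  by apply: set_fieldU => //; [exact: FA | exact: FB].
by apply: set_fieldD => //; [exact: FA | exact: FB].
Qed.

(** * Alternating sequences *)

Definition good (R : realType) (T W : Type) (m : set T -> R) (E : T -> W -> Prop)
    (e : R) (X : set T) : Prop :=
  forall w, m (X `&` E ^~ w) <= e * m X \/ m (X `\` E ^~ w) <= e * m X.

(** A union bound: the bad sets are removed from [X] one by one, and their total measure stays below
    [m X]. *)
Lemma fa_avoid (R : realType) (T : Type) (F : set (set T)) (m : set T -> R)
    (I : Type) (s : seq I) (bad : I -> set T) (c : R) (X : set T) :
  set_field F -> fa_probability F m -> F X -> (forall i, F (bad i)) ->
  all (fun i => m (bad i) <= c) s -> (size s)%:R * c < m X ->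
  exists2 x, X x & all (fun i => `[< ~ bad i x >]) s.
Proof.
move=> fF pm + Fbad; elim: s X => [|i s IHs] X FX /=.
  by rewrite mul0r => _ /(fa_nonempty fF pm)[x Xx]; exists x.
move=> /andP[mi ms]; rewrite mulrS mulrDl mul1r => sX.
have FXi : F (X `\` bad i) by exact: set_fieldD.
have [] // := IHs (X `\` bad i) => [|x [Xx ix] Hx]; last first.
  by exists x => //; apply/andP; split=> //; exact/asboolP.
have := fa_split fF pm FX (Fbad i).
have : m (X `&` bad i) <= m (bad i).
  by apply: (fa_mono fF pm) => //; exact: set_fieldI.
by lra.
Qed.

Section Dichotomy.
Context (R : realType) (T U : Type) (FT : set (set T)) (FU : set (set U)).
Context (mu : set T -> R) (nu : set U -> R) (r : T -> U -> Prop).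
Hypotheses (fieldT : set_field FT) (fieldU : set_field FU).
Hypotheses (probT : fa_probability FT mu) (probU : fa_probability FU nu).
Hypothesis sectionT : forall y, FT [set a | r a y].
Hypothesis sectionU : forall a, FU (r a).
Context (A : set T) (B B1 B2 : set U) (e g : R) (N : nat).
Hypotheses (FA : FT A) (FB : FU B) (FB1 : FU B1) (FB2 : FU B2).
Hypotheses (B1_sub : B1 `<=` B) (B2_sub : B2 `<=` B).
Hypothesis A_gt0 : 0 < mu A.
Hypothesis goodB : good nu (fun y a => r a y) e B.
Hypothesis sectB1 : forall y, B1 y -> mu (A `\` [set a | r a y]) <= g * mu A.
Hypothesis sectB2 : forall y, B2 y -> mu (A `&` [set a | r a y]) <= g * mu A.
Hypothesis B1_large : N%:R * e * nu B < nu B1.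
Hypothesis B2_large : N%:R * e * nu B < nu B2.
Hypothesis g_small : 2 * N%:R * g < 1.
Hypotheses (e_ge0 : 0 <= e) (g_ge0 : 0 <= g).

(** The majority value of [a] on [B]: as [B] is good, [rb a y] equals [large a] for all [y] in [B]
    outside a set of measure at most [e * nu B]. *)
Let large (a : T) : bool := `[< nu (B `\` r a) <= e * nu B >].
Let rb (a : T) (y : U) : bool := `[< r a y >].

(** Each round first picks a point of [B1] and one of [B2] that follow the majority value of every
    earlier [a], then a new [a] in [A] that separates the new pair and all older pairs. Both choices
    are union bounds, paid for by [B1_large], [B2_large] and [g_small]. *)
Lemma alternating_sequence n : (n <= N)%N ->
  exists s : seq (T * (U * U)),
    [/\ size s = n,
        all (fun t => `[< B1 t.2.1 /\ B2 t.2.2 >]) s,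
        all (fun t => rb t.1 t.2.1 && ~~ rb t.1 t.2.2) s &
        pairwise (fun t u => [&& rb u.1 t.2.1 == large u.1,
          rb u.1 t.2.2 == large u.1, rb t.1 u.2.1 & ~~ rb t.1 u.2.2]) s].
Proof.
elim: n => [|n IHn] nN; first by exists [::].
have [s [size_s Bs selfs pairs]] := IHn (ltnW nN).
(* The part of [B] on which [u.1] departs from its majority value. *)
pose bad (u : T * (U * U)) : set U :=
  if large u.1 then B `\` r u.1 else B `&` r u.1.
have Fbad u : FU (bad u).
  by rewrite /bad; case: ifP => _; [exact: set_fieldD | exact: set_fieldI].
have mbad : all (fun u => nu (bad u) <= e * nu B) s.
  apply: sub_all (all_predT s) => u _; rewrite /bad /large.
  by case: asboolP; case: (goodB u.1).
have sB (Bi : set U) : N%:R * e * nu B < nu Bi -> (size s)%:R * (e * nu B) < nu Bi.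
  rewrite size_s mulrA; apply: le_lt_trans; rewrite -!mulrA; apply: ler_wpM2r.
    by rewrite mulr_ge0// (fa_ge0 probU).
  by rewrite ler_nat ltnW.
have outside y (Bi : set U) : Bi `<=` B -> Bi y ->
    all (fun u => `[< ~ bad u y >]) s -> all (fun u => rb u.1 y == large u.1) s.
  move=> BiB Biy; apply: sub_all => u /asboolP; rewrite /bad /rb.
  case: (large u.1) => bad_y; apply/eqP.
    by apply/asboolP; apply: contrapT => nr; apply: bad_y; split=> //; exact: BiB.
  by apply/asboolP => ry; apply: bad_y; split=> //; exact: BiB.
have [y1 B1y1 /(outside _ _ B1_sub B1y1) out1] :=
  fa_avoid fieldU probU FB1 Fbad mbad (sB _ B1_large).
have [y2 B2y2 /(outside _ _ B2_sub B2y2) out2] :=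
  fa_avoid fieldU probU FB2 Fbad mbad (sB _ B2_large).
(* The new pair is included, since the next [a] has to separate it too; hence up to [N] pairs, each
   costing [2 * g * mu A]. *)
pose yy := (y1, y2) :: map snd s.
have Byy : all (fun p => `[< B1 p.1 /\ B2 p.2 >]) yy.
  by rewrite /= all_map; apply/andP; split; [exact/asboolP | exact: Bs].
pose bad' (p : U * U) : set T :=
  A `\` [set a | r a p.1] `|` A `&` [set a | r a p.2].
have Fbad' p : FT (bad' p).
  by apply: set_fieldU => //; [exact: set_fieldD | exact: set_fieldI].
have mbad' : all (fun p => mu (bad' p) <= 2 * g * mu A) yy.
  apply: sub_all Byy => p /asboolP[Bp1 Bp2].
  apply: le_trans (fa_setUle fieldT probT _ _) _; first exact: set_fieldD.
    exact: set_fieldI.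
  by have := sectB1 Bp1; have := sectB2 Bp2; lra.
have syy : (size yy)%:R * (2 * g * mu A) < mu A.
  rewrite /= size_map size_s -{2}(mul1r (mu A)) mulrA ltr_pM2r//.
  apply: le_lt_trans g_small; rewrite mulrA (mulrC 2); apply: ler_wpM2r => //.
  by rewrite ler_pM2r ?ler_nat.
have [a Aa] := fa_avoid fieldT probT FA Fbad' mbad' syy.
move=> /(sub_all (a2 := fun p => rb a p.1 && ~~ rb a p.2)) Ha.
have {Ha} /= : all (fun p => rb a p.1 && ~~ rb a p.2) yy.
  apply: Ha => p /asboolP bad_a; apply/andP; split.
    by apply/asboolP; apply: contrapT => nr; apply: bad_a; left.
  by apply/asboolPn => ra; apply: bad_a; right.
rewrite all_map => /andP[self_a older_a].
exists ((a, (y1, y2)) :: s); split=> /=.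
- by rewrite size_s.
- by rewrite Bs andbT; exact/asboolP.
- by rewrite self_a.
- rewrite pairs andbT.
  have : all (predI (fun u => rb u.1 y1 == large u.1)
    (predI (fun u => rb u.1 y2 == large u.1)
      (fun u => rb a u.2.1 && ~~ rb a u.2.2))) s.
    by rewrite all_predI out1 all_predI out2; exact: older_a.
  by apply: sub_all => u /= /and3P[-> ->].
Qed.

(** By pigeonhole, [2 ^ d] entries share a majority value. Keeping from each pair the point on which
    [a] takes the other value gives a half graph: points of [B2] if the majority value is true,
    points of [B1] if it is false. *)
Lemma dichotomy_split_tree (d : nat) :
  N = (2 ^ d.+1)%N -> split_tree (fun y a => r a y) d setT.
Proof.
move=> Nd.
have [s [size_s _ selfs pairs]] := alternating_sequence (leqnn N).
have rbE : (fun y a => r a y) = (fun y a => rb a y : Prop).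
  by apply/funext => y; apply/funext => a; rewrite /rb asboolE.
rewrite rbE.
have topP (s' : seq (T * U)) : all (fun t => `[< setT t.2 >]) s'.
  by apply: sub_all (all_predT s') => t _; exact/asboolP.
have [sizeL|sizeS] : (2 ^ d <= count (fun t => large t.1) s)%N \/
    (2 ^ d <= count (fun t => ~~ large t.1) s)%N.
  have := count_predC (fun t => large t.1) s; rewrite size_s Nd expnS.
  by rewrite (eq_count (a1 := predC _) (a2 := fun t => ~~ large t.1))//; lia.
- apply: (@half_graph_split_tree _ _ rb true d
    [seq (t.1, t.2.2) | t <- [seq t <- s | large t.1]]) => //.
  + by rewrite size_map size_filter.
  + rewrite all_map all_filter; apply: sub_all selfs => t /andP[_ nr] /=.
    by rewrite (negbTE nr) implybT.
  + rewrite pairwise_map.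
    apply: sub_in_pairwise (filter_all _ s) (pairwise_filter _ pairs).
    move=> t u _ Lu /and4P[_ /eqP /= -> _ /negbTE ->].
    by rewrite (Lu : large u.1).
- apply: (@half_graph_split_tree _ _ rb false d
    [seq (t.1, t.2.1) | t <- [seq t <- s | ~~ large t.1]]) => //.
  + by rewrite size_map size_filter.
  + rewrite all_map all_filter; apply: sub_all selfs => t /andP[r1 _] /=.
    by rewrite r1 implybT.
  + rewrite pairwise_map.
    apply: sub_in_pairwise (filter_all _ s) (pairwise_filter _ pairs).
    move=> t u _ Lu /and4P[/eqP /= -> _ -> _].
    by rewrite (negbTE (Lu : ~~ large u.1)).
Qed.

End Dichotomy.

(** * Partitions into good sets *)

Section GoodPartition.
Context (R : realType) (T W : Type) (F : set (set T)) (m : set T -> R).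
Context (E : T -> W -> Prop) (d : nat) (e : R).
Hypotheses (fieldF : set_field F) (probm : fa_probability F m).
Hypothesis sectionF : forall w, F (E ^~ w).
Hypotheses (e_gt0 : 0 < e) (e_le1 : e <= 1).

(** If [X] is not good, some fibre cuts it into two parts of measure above [e * m X], one of which
    has no tree of the next smaller height; the search continues there at the cost of a factor [e].
    At height 0, having no tree means being empty. *)
Lemma good_subset n X :
  ~ split_tree E n X -> F X -> 0 < m X ->
  exists Z, [/\ F Z, good m E e Z, Z `<=` X & e ^+ n * m X <= m Z].
Proof.
elim: n X => [|n IHn] X treeX FX mX.
  by case: treeX; exact: (fa_nonempty fieldF probm).
have [gX|/existsNP[w /not_orP[/negP + /negP]]] := pselect (good m E e X).
  exists X; split=> //; apply: ler_piMl; first exact: ltW.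
  by rewrite exprn_ile1// ltW.
rewrite -!ltNge => mI mD.
have descend Y : ~ split_tree E n Y -> F Y -> Y `<=` X -> e * m X < m Y ->
    exists Z, [/\ F Z, good m E e Z, Z `<=` X & e ^+ n.+1 * m X <= m Z].
  move=> treeY FY YX mY.
  have [|Z [FZ gZ ZY mZ]] := IHn Y treeY FY.
    by apply: lt_trans mY; exact: mulr_gt0.
  exists Z; split=> //; first exact: subset_trans YX.
  apply: le_trans mZ; rewrite exprSr -mulrA; apply: ler_wpM2l; last exact: ltW.
  by rewrite exprn_ge0// ltW.
have [tI|tI] := pselect (split_tree E n (X `&` E ^~ w)); last first.
  by apply: descend tI _ _ mI; [exact: set_fieldI | move=> x []].
have [tD|tD] := pselect (split_tree E n (X `\` E ^~ w)); last first.
  by apply: descend tD _ _ mD; [exact: set_fieldD | move=> x []].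
by case: treeX; exists w.
Qed.

(** Adding [Z] raises the minority part of any fibre by at most [m Z], hence the factor 2. *)
Lemma good_absorb A Z :
  F A -> F Z -> good m E e A -> m Z <= e * m A -> good m E (2 * e) (A `|` Z).
Proof.
move=> FA FZ gA mZ w; have FU : F (A `|` Z) by exact: set_fieldU.
have mA0 := fa_ge0 probm FA; have mAU : m A <= m (A `|` Z).
  by apply: (fa_mono fieldF probm) => // x; left.
have emA : e * m A <= e * m (A `|` Z) by rewrite ler_pM2l.
have [H|H] := gA w; [left; rewrite setIUl | right; rewrite setDUl].
  apply: le_trans (fa_setUle fieldF probm _ _) _; try exact: set_fieldI.
  have : m (Z `&` E ^~ w) <= m Z.
    by apply: (fa_mono fieldF probm) => //; exact: set_fieldI.
  by lra.
apply: le_trans (fa_setUle fieldF probm _ _) _; try exact: set_fieldD.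
have : m (Z `\` E ^~ w) <= m Z.
  by apply: (fa_mono fieldF probm) => //; exact: set_fieldD.
by lra.
Qed.

Lemma good_peel n X : ~ split_tree E d setT -> F X ->
  exists (s : seq (set T)) (Z : set T),
    [/\ (size s <= n)%N,
        F Z /\ m Z <= (1 - e ^+ d) ^+ n * m X,
        forall A, A \in s -> [/\ F A, good m E e A & 0 < m A],
        X = Z `|` \bigcup_(A in [set` s]) A &
        trivIset [set` s] id /\ forall A, A \in s -> A `&` Z = set0].
Proof.
move=> noTree.
elim: n X => [|n IHn] X FX.
  exists [::], X; split=> //.
  - by rewrite mul1r.
  - by rewrite bigcup_seq big_nil setU0.
(* Peeling stops early on a null set, so that every piece has positive measure. *)
have [mX0|mX0] := eqVneq (m X) 0.
  exists [::], X; split=> //.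
  - by rewrite mX0 mulr0.
  - by rewrite bigcup_seq big_nil setU0.
have mX : 0 < m X by rewrite lt0r mX0 (fa_ge0 probm).
have treeX : ~ split_tree E d X.
  by move=> tX; apply: noTree; apply: split_tree_sub tX.
have [A [FA gA AX mA]] := good_subset treeX FX mX.
have mA0 : 0 < m A by apply: lt_le_trans mA; rewrite mulr_gt0// exprn_gt0.
have FXA : F (X `\` A) by exact: set_fieldD.
have [s [Z [size_s [FZ mZ] sP XA [triv sZ]]]] := IHn _ FXA.
have sub (B : set T) : B `<=` X `\` A -> A `&` B = set0.
  by move=> BXA; rewrite -subset0 => x [Ax /BXA[]].
have subs B : B \in s -> B `<=` X `\` A.
  by move=> Bs; rewrite XA => x Bx; right; exists B.
have subZ : Z `<=` X `\` A by rewrite XA => x Zx; left.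
exists (A :: s), Z; split=> //=.
- split=> //; apply: le_trans mZ _; rewrite exprSr -mulrA; apply: ler_wpM2l.
    by rewrite exprn_ge0// subr_ge0 exprn_ile1// ltW.
  have := fa_split fieldF probm FX FA; rewrite (setIidr AX).
  by move: mA; rewrite mulrBl mul1r; lra.
- by move=> B; rewrite inE => /orP[/eqP ->|/sP].
- rewrite bigcup_seq big_cons -bigcup_seq setUCA -XA.
  by rewrite setDUK.
- split; last first.
    by move=> B; rewrite inE => /orP[/eqP ->|/sZ//]; exact: sub.
  move=> B C /=; rewrite !inE => /orP[/eqP ->|Bs] /orP[/eqP ->|Cs] //.
  + by rewrite (sub C (subs C Cs)) => -[].
  + by rewrite setIC (sub B (subs B Bs)) => -[].
  + exact: triv.
Qed.

(** About [e ^ -d] rounds halve the remainder, by Bernoulli applied to [1 + e ^+ d] and the bound 1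
    on the product of the two powers. About [1 / e] halvings give a factor [e], since [2 ^ l]
    exceeds [l]; doing this [d.+1] times gives [e ^ (d + 1)]. Using [1 / e] halvings in place of a
    logarithm yields the exponent [d.+1] in the count. *)
Lemma peel_bound :
  exists n, (1 - e ^+ d) ^+ n <= e * e ^+ d /\
    n%:R <= (4 * d.+1)%:R * e^-1 ^+ d.+1.
Proof.
have x1 : 1 <= e^-1 by rewrite invf_ge1.
have xd1 : 1 <= e^-1 ^+ d by rewrite exprn_ege1.
pose a := (Num.trunc (e^-1 ^+ d)).+1; pose l := (Num.trunc e^-1).+1.
have /andP[a1 a2] := truncn_itv (le_trans ler01 xd1).
have /andP[l1 l2] := truncn_itv (le_trans ler01 x1).
have ha : a%:R <= 2 * e^-1 ^+ d by rewrite /a -natr1; lra.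
have hl : l%:R <= 2 * e^-1 by rewrite /l -natr1; lra.
have ed0 : 0 < e ^+ d by rewrite exprn_gt0.
have ed1 : e ^+ d <= 1 by rewrite exprn_ile1// ltW.
have bernoulli n : 1 + n%:R * e ^+ d <= (1 + e ^+ d) ^+ n.
  elim: n => [|n IHn]; first by rewrite mul0r addr0.
  rewrite exprS -natr1.
  have : 0 <= n%:R :> R by [].
  by nra.
have half : (1 - e ^+ d) ^+ a <= 2^-1.
  have : (1 - e ^+ d) ^+ a * (1 + e ^+ d) ^+ a <= 1.
    rewrite -exprMn exprn_ile1//; nra.
  have : 2 <= (1 + e ^+ d) ^+ a.
    apply: le_trans (bernoulli a).
    have : e^-1 ^+ d * e ^+ d <= a%:R * e ^+ d.
      by rewrite ler_pM2r// ltW.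
    rewrite -exprMn mulVf ?gt_eqF// expr1n; lra.
  have : 0 <= (1 - e ^+ d) ^+ a by rewrite exprn_ge0// subr_ge0.
  by nra.
have twol : 2^-1 ^+ l <= e.
  rewrite exprVn -[leRHS]invrK lef_pV2 ?posrE ?invr_gt0 ?exprn_gt0//.
  apply: le_trans (ltW l2) _.
  by rewrite -natrX ler_nat ltnW// ltn_expl.
exists (a * l * d.+1)%N; split.
  have decay0 : 0 <= (1 - e ^+ d) ^+ a by rewrite exprn_ge0// subr_ge0.
  rewrite -exprS !exprM; apply: lerXn2r.
  - by rewrite nnegrE exprn_ge0.
  - by rewrite nnegrE ltW.
  by apply: le_trans twol; apply: lerXn2r; rewrite ?nnegrE// invr_ge0.
rewrite !natrM (mulrC (4%:R)) [leLHS]mulrC -mulrA; apply: ler_wpM2l => //.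
rewrite exprSr (_ : 4%:R * _ = (2 * e^-1 ^+ d) * (2 * e^-1)); last by ring.
exact: ler_pM.
Qed.

(** The piece [A] that will absorb the remainder is taken first: as [m A] is at least [e ^+ d], a
    remainder of measure at most [e * e ^+ d] is an [e]-fraction of it. *)
Lemma good_partition : ~ split_tree E d setT ->
  exists P : set (set T),
    [/\ finite_set P, partition P id [set: T],
        forall A, P A -> [/\ F A, good m E (2 * e) A & 0 < m A] &
        #|` fset_set P|%:R <= (4 * d.+1).+1%:R * e^-1 ^+ d.+1].
Proof.
move=> noTree.
have FT := set_fieldT fieldF; have mT := fa_setT probm.
have [|A [FA gA _]] := good_subset noTree FT; first by rewrite mT.
rewrite mT mulr1 => mA.
have ed0 : 0 < e ^+ d by rewrite exprn_gt0.
have FTA : F (setT `\` A) by exact: set_fieldD.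
have [n [decay nle]] := peel_bound.
have [s [Z [size_s [FZ mZ] sP TA [triv sZ]]]] := good_peel n noTree FTA.
have mZA : m Z <= e * m A.
  have mTA1 : m (setT `\` A) <= 1 by rewrite -mT; apply: (fa_mono fieldF probm).
  have mTA0 := fa_ge0 probm FTA.
  have eed0 : 0 <= e * e ^+ d by apply: mulr_ge0; apply: ltW.
  have := ler_piMr eed0 mTA1.
  have : e * e ^+ d <= e * m A by rewrite ler_pM2l.
  have : (1 - e ^+ d) ^+ n * m (setT `\` A) <= (e * e ^+ d) * m (setT `\` A).
    exact: ler_wpM2r.
  by lra.
have FAZ : F (A `|` Z) by exact: set_fieldU.
have mAZ : 0 < m (A `|` Z).
  apply: lt_le_trans (lt_le_trans ed0 mA) _.
  by apply: (fa_mono fieldF probm) => // x; left.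
have subs B : B \in s -> (A `|` Z) `&` B = set0.
  move=> Bs; rewrite setIUl (setIC Z) (sZ _ Bs) setU0 -subset0 => x [Ax Bx].
  have : (setT `\` A) x by rewrite TA; right; exists B.
  by case.
have partP B : B \in (A `|` Z) :: s -> [/\ F B, good m E (2 * e) B & 0 < m B].
  rewrite inE => /orP[/eqP ->|/sP[FB gB mB]].
    by split=> //; exact: good_absorb.
  split=> // w; have : 0 < e * m B by exact: mulr_gt0.
  by case: (gB w) => ? ?; [left | right]; lra.
exists [set` (A `|` Z) :: s]; split=> //.
- split.
  + rewrite /cover bigcup_seq big_cons -bigcup_seq -setUA -TA.
    by rewrite setDUK.
  + move=> B C /=; rewrite !inE => /orP[/eqP ->|Bs] /orP[/eqP ->|Cs] //.
    * by rewrite (subs C Cs) => -[].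
    * by rewrite setIC (subs B Bs) => -[].
    * exact: triv.
  + by move=> B /partP[_ _]; exact: (fa_nonempty fieldF probm).
- have /= : (#|` fset_set [set` (A `|` Z) :: s]| <= size ((A `|` Z) :: s))%N.
    apply: uniq_leq_size; first exact: fset_uniq.
    by move=> B; rewrite in_fset_set; [move/set_mem | exact: finite_seq].
  rewrite -(ler_nat R) => /le_trans; apply.
  have : (size s).+1%:R <= n.+1%:R :> R by rewrite ler_nat.
  move=> /le_trans; apply.
  (* The extra 1 in the constant counts the piece that absorbed the remainder. *)
  rewrite -(natr1 n) -(natr1 (4 * d.+1)) mulrDl mul1r; apply: lerD => //.
  by apply: exprn_ege1; rewrite invf_ge1.
Qed.

End GoodPartition.

(** * Densities of products of good sets *)

(** [B1] collects the points of [B] whose fibre has density above one half in [A], [B2] the others.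
    Either one of them has measure at most [N * e * nu B], which adds [N * e] to the error [g] of
    the fibres, or both are large enough to build a tree. *)
Lemma integral_zero_one (R : realType) (T U : Type) (FT : set (set T))
    (FU : set (set U)) (mu : set T -> R) (nu : set U -> R) (r : T -> U -> Prop)
    (A : set T) (B : set U) (e g v : R) (d : nat) :
  set_field FT -> set_field FU -> fa_probability FT mu -> fa_probability FU nu ->
  (forall y, FT [set a | r a y]) -> (forall a, FU (r a)) ->
  FT A -> FU B -> 0 < mu A ->
  good mu r g A -> good nu (fun y a => r a y) e B ->
  0 <= e -> 0 <= g -> 2 * (2 ^ d.+1)%:R * g < 1 ->
  ~ split_tree (fun y a => r a y) d setT ->
  is_fa_integral FU nu (fun y => mu (A `&` [set a | r a y]) * \1_B y) v ->
  let g' := g + (2 ^ d.+1)%:R * e in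
  v <= g' * (mu A * nu B) \/ mu A * nu B - v <= g' * (mu A * nu B).
Proof.
move=> fT fU pT pU sT sU FA FB A0 gA gB e0 g0; set N := (2 ^ d.+1)%N => Ng.
move=> noTree intf g'; rewrite {}/g'.
set f := (fun y => _) in intf; set c := mu A in A0 *.
have {}gA y : mu (A `&` [set a | r a y]) <= g * c \/
    mu (A `\` [set a | r a y]) <= g * c by exact: gA.
have N2 : 2 <= N%:R :> R.
  by rewrite (ler_nat R 2) /N expnS leq_pmulr// expn_gt0.
have g4 : 4 * g < 1 by nra.
have nuB0 := fa_ge0 pU FB.
have fB y : B y -> f y = mu (A `&` [set a | r a y]).
  by move=> By; rewrite /f indicE mem_set// mulr1.
have fNB y : ~ B y -> f y = 0.
  by move=> By; rewrite /f indicE memNset// mulr0.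
have splitA y : c = mu (A `&` [set a | r a y]) + mu (A `\` [set a | r a y]).
  exact: (fa_split fT pT).
have posD y : 0 <= mu (A `\` [set a | r a y]).
  by apply: (fa_ge0 pT); exact: set_fieldD.
have posI y : 0 <= mu (A `&` [set a | r a y]).
  by apply: (fa_ge0 pT); exact: set_fieldI.
have gc : g * c < c / 4 by nra.
pose B1 := [set y | c / 2 < f y]; pose B2 := B `\` B1.
have FB1 : FU B1.
  (* Goodness of [A] with [g < 1 / 4] keeps [f] out of the open interval from [c / 4] to
     [3 * c / 4]; this gap makes [B1] measurable. *)
  apply: (fa_integral_level_field fU intf (e := c / 4)); first by lra.
  move=> y; have [By|By] := pselect (B y); last by rewrite fNB//; left; lra.
  rewrite fB//; have := splitA y.
  by case: (gA y) => ? ?; [left | right]; lra.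
have FB2 : FU B2 by exact: set_fieldD.
have B1B : B1 `<=` B.
  move=> y; rewrite /B1 /= => fy; apply: contrapT => By.
  by move: fy; rewrite fNB//; lra.
have B12 : B1 `&` B2 = set0 by rewrite /B2 setIDA setDE setIAC setICr set0I.
have nuB12 : nu B = nu B1 + nu B2.
  by rewrite (fa_split fU pU FB FB1) (setIidr B1B).
have nu1 := fa_ge0 pU FB1; have nu2 := fa_ge0 pU FB2.
have B1U2 y : ~ (B1 `|` B2) y -> ~ B y.
  by move=> nB By; apply: nB; have [|] := pselect (B1 y); [left | right].
have on1 y : B1 y -> mu (A `\` [set a | r a y]) <= g * c.
  move=> B1y; case: (gA y) => //.
  by move: (B1y); rewrite /B1 /= fB; [lra | exact: B1B].
have on2 y : B2 y -> mu (A `&` [set a | r a y]) <= g * c.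
  move=> [By /negP]; rewrite -leNgt fB// => ?.
  by case: (gA y) => //; have := splitA y; lra.
have [small1|large1] := leP (nu B1) (N%:R * e * nu B).
  left; have : v <= c * nu B1 + (g * c) * nu B2.
    apply: (fa_integral_le fU pU FB1 FB2 B12 intf).
    - by move=> y B1y; rewrite fB; [have := splitA y; have := posD y; lra | exact: B1B].
    - by move=> y B2y; rewrite fB; [exact: on2 | case: B2y].
    - by move=> y /B1U2/fNB ->.
  have : c * nu B1 <= c * (N%:R * e * nu B) by rewrite ler_pM2l.
  have : 0 <= g * c * nu B1 by rewrite mulr_ge0// mulr_ge0// ltW.
  by rewrite nuB12; lra.
have [small2|large2] := leP (nu B2) (N%:R * e * nu B).
  right; have : (c - g * c) * nu B1 + 0 * nu B2 <= v.
    apply: (fa_integral_ge fU pU FB1 FB2 B12 intf).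
    - move=> y B1y; rewrite fB; last exact: B1B.
      by have := splitA y; have := on1 y B1y; lra.
    - by move=> y B2y; rewrite fB; [exact: posI | case: B2y].
    - by move=> y /B1U2/fNB ->.
  have : c * nu B2 <= c * (N%:R * e * nu B) by rewrite ler_pM2l.
  have : 0 <= g * c * nu B2 by rewrite mulr_ge0// mulr_ge0// ltW.
  by rewrite nuB12; lra.
by case: noTree; apply: (@dichotomy_split_tree R T U FT FU mu nu r fT fU pT pU
  sT sU A B B1 B2 e g N) => // y [].
Qed.

(** * Points of partial products and their fibres *)

Section Points.
Context (k : nat) (V : 'I_k -> Type) (Q : set (forall i, V i)).

(** Fibres over [subprod V (~: I)] are parametrised by full points [x], so that one [x] can serve
    for all [I]. *)
Definition glue (I : {set 'I_k}) (a : subprod V I) (x : forall i, V i) :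
    forall i, V i :=
  fun i => match pselect (i \in I) with
           | left h => a i h
           | right _ => x i
           end.

Lemma glue_in I (a : subprod V I) x i (h : i \in I) : glue a x i = a i h.
Proof.
rewrite /glue; case: pselect => // h'.
by congr (a i _); exact: bool_irrelevance.
Qed.

Lemma glue_out I (a : subprod V I) x i : i \notin I -> glue a x i = x i.
Proof. by rewrite /glue => /negP; case: pselect. Qed.

Lemma proj_eq I (x y : forall i, V i) :
  (proj I x = proj I y) <-> (forall i, i \in I -> x i = y i).
Proof.
split=> [xy i iI|xy]; first exact: (congr1 (fun a : subprod V I => a i iI) xy).
by apply: functional_extensionality_dep => i;
  apply: functional_extensionality_dep => iI; exact: xy.
Qed.

Lemma proj_glue I (a : subprod V I) x : proj I (glue a x) = a.
Proof.
by apply: functional_extensionality_dep => i;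
  apply: functional_extensionality_dep => iI; exact: glue_in.
Qed.

Lemma glue_eq I (a : subprod V I) x z :
  proj I z = a -> proj (~: I) z = proj (~: I) x -> z = glue a x.
Proof.
move=> <- /proj_eq zx; apply: functional_extensionality_dep => i.
have [iI|iI] := boolP (i \in I); first by rewrite (glue_in _ _ iI).
by rewrite glue_out// zx// inE.
Qed.

Lemma proj_glueC I (a : subprod V I) x : proj (~: I) (glue a x) = proj (~: I) x.
Proof. by apply/proj_eq => i; rewrite inE => /glue_out ->. Qed.

Lemma fibreE I x : fibre Q (proj (~: I) x) = [set a | Q (glue a x)].
Proof.
apply/seteqP; split=> a /=; first by move=> [z [Qz za zx]]; rewrite -(glue_eq za zx).
by move=> Qa; exists (glue a x); rewrite proj_glue proj_glueC.
Qed.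

Lemma fibre1E i x : fibre1 Q (proj (~: [set i]%SET) x) = [set y | Q (dfwith x i y)].
Proof.
apply/seteqP; split=> y /=.
  move=> [z [Qz zi /proj_eq zx]]; suff -> : dfwith x i y = z by [].
  apply: functional_extensionality_dep => j; case: dfwithP => [//|j' ij].
  by rewrite zx// !inE eq_sym.
move=> Qy; exists (dfwith x i y); split=> //; first exact: dfwithin.
by apply/proj_eq => j; rewrite !inE eq_sym => ij; rewrite dfwithout.
Qed.

Lemma glue_dfwith (i : 'I_k) (a : subprod V (below k i)) x (y : V i) :
  glue a (dfwith x i y) = dfwith (glue a x) i y.
Proof.
apply: functional_extensionality_dep => j; case: (dfwithP (glue a x)) => [|j' ij].
  by rewrite glue_out ?dfwithin// inE ltnn.
have [h|h] := boolP (j' \in below k i); first by rewrite !(glue_in _ _ h).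
by rewrite !glue_out// dfwithout.
Qed.

(** This identifies the integrand in [is_ltimes] with the measure of fibres on the previous partial
    product, which is what the induction on factors controls. *)
Lemma section_fibre (i : 'I_k) x (y : V i) :
  section_at (@split_last k V i) (fibre Q (proj (~: below k i.+1) x)) y =
  fibre Q (proj (~: below k i) (dfwith x i y)).
Proof.
rewrite !fibreE; apply/seteqP; split=> t /=.
  move=> [a Qa [at_ ay]]; suff -> : glue t (dfwith x i y) = glue a x by [].
  apply: functional_extensionality_dep => j.
  have [h|h] := boolP (j \in below k i).
    by rewrite (glue_in _ _ h) (glue_in _ _ (below_widen h)) -at_.
  rewrite glue_out//; case: dfwithP h => [|j' ij] h.
    by rewrite -ay (glue_in _ _ (below_last i)).
  rewrite glue_out//; move: h; rewrite !inE -!leqNgt => h.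
  by rewrite ltn_neqAle h andbT; apply: contra ij => /eqP/val_inj ->.
move=> Qt; exists (proj (below k i.+1) (glue t (dfwith x i y))) => /=.
  rewrite (_ : glue _ x = glue t (dfwith x i y))//.
  apply/esym/glue_eq => //; apply/proj_eq => j; rewrite !inE -leqNgt => ij.
  rewrite glue_out ?inE -?leqNgt 1?ltnW// dfwithout//.
  by apply: contraTneq ij => ->; rewrite ltnn.
rewrite /split_last; congr pair.
  apply: functional_extensionality_dep => j;
  by apply: functional_extensionality_dep => jI; rewrite /proj (glue_in _ _ jI).
by rewrite /proj glue_out ?dfwithin// inE ltnn.
Qed.

Lemma stable_no_tree1 (d : nat) (i : 'I_k) (x0 : forall i, V i) :
  stable Q d ->
  ~ split_tree (fun y (b : subprod V (~: [set i]%SET)) => fibre1 Q b y) d setT.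
Proof.
move=> /(_ [set i]%SET) stab tree; move: stab; rewrite -/(~ _).
apply: (split_tree_unstable (f := fun y => proj [set i]%SET (dfwith x0 i y)) (g := id)
  (proj _ x0) _ tree) => y b; split=> -[z [Qz zy zb]]; exists z; split=> //.
  by move/proj_eq : zy => /(_ i); rewrite dfwithin inE => ->.
by apply/proj_eq => j; rewrite inE => /eqP ->; rewrite dfwithin.
Qed.

(** Completing [a] by the coordinates of [x0] embeds the relation into [Q] viewed on [V i] times the
    other factors, so a tree for it is a tree for [Q]. *)
Lemma stable_no_tree_glue (d : nat) (i : 'I_k) (x0 : forall i, V i) :
  stable Q d ->
  ~ split_tree (fun y (a : subprod V (below k i)) => Q (glue a (dfwith x0 i y)))
      d setT.
Proof.
move=> /(_ [set i]%SET) stab tree; move: stab; rewrite -/(~ _).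
apply: (split_tree_unstable (f := fun y => proj [set i]%SET (dfwith x0 i y))
  (g := fun a => proj (~: [set i]%SET) (glue a x0)) (proj _ x0) _ tree) => y a.
rewrite glue_dfwith fibreE /=.
rewrite (_ : glue _ _ = dfwith (glue a x0) i y)//.
apply/esym/glue_eq; apply/proj_eq => j; rewrite !inE; first by move=> /eqP ->; rewrite !dfwithin.
by rewrite eq_sym => ij; rewrite !dfwithout.
Qed.

End Points.

(** * Zero-one densities in the iterated product *)

Section Product.
Context (k : nat) (V : 'I_k -> Type) (Q : set (forall i, V i)) (R : realType).
Context (B : forall i, set (set (V i))) (mu : forall i, set (V i) -> R).
Hypothesis fieldB : forall i, set_field (@B i).
Hypothesis fibre1B : forall i b, @B i (fibre1 Q b).
Hypothesis probB : forall i, fa_probability (@B i) (@mu i).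

Definition partial_box (m : nat) (Y : forall i, set (V i)) :
    set (subprod V (below k m)) :=
  [set a | forall i hi, Y i (a i hi)].
Arguments partial_box : clear implicits.

Lemma prod_field_set_field m (h : (m <= k)%N) : set_field (prod_field Q B h).
Proof. by case: m h => [|m] h //=; exact: gen_field_set_field. Qed.

Lemma prod_field_fibre m (h : (m <= k)%N) (b : subprod V (~: below k m)) :
  prod_field Q B h (fibre Q b).
Proof.
case: m h b => [//|m] h b; apply: sub_gen_smallest; right.
by apply: sub_gen_smallest; exists b.
Qed.

Lemma partial_boxS m (h : (m < k)%N) Y :
  partial_box m.+1 Y =
  rectangle (@split_last k V (Ordinal h)) (partial_box m Y) (Y (Ordinal h)).
Proof.
apply/seteqP; split=> a /=.
  by move=> Ya; split=> [i hi|]; exact: Ya.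
move=> [Ya1 Ya2] i hi; have [im|im] := boolP (i \in below k m).
  have := Ya1 i im; rewrite /split_last /=.
  by rewrite (bool_irrelevance (@below_widen k (Ordinal h) i im) hi).
have iE : i = Ordinal h.
  by apply/val_inj/eqP; move: hi im; rewrite !inE /= ltnS eqn_leq -leqNgt => -> ->.
subst i; move: Ya2; rewrite /split_last /=.
by rewrite (bool_irrelevance (below_last _) hi).
Qed.

Lemma prod_field_box m (h : (m <= k)%N) Y :
  (forall i, @B i (Y i)) -> prod_field Q B h (partial_box m Y).
Proof.
move=> BY; elim: m h => [//|m IHm] h; rewrite (partial_boxS h).
apply: sub_gen_smallest; left.
by exists (partial_box m Y), (Y (Ordinal h)); split=> //; exact: IHm.
Qed.

Lemma partial_product_fa m (h : (m <= k)%N) M :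
  is_partial_product Q B mu h M -> fa_probability (prod_field Q B h) M.
Proof. by case: m h M => [|m] h M //= [M' _ []]. Qed.

Context (d : nat) (X : forall i, set (V i)) (e : R).
Hypothesis stableQ : stable Q d.
Hypothesis BX : forall i, @B i (@X i).
Hypothesis X_gt0 : forall i, 0 < @mu i (@X i).
Hypothesis goodX : forall i,
  good (@mu i) (fun y (b : subprod V (~: [set i]%SET)) => fibre1 Q b y) e (@X i).
Hypothesis e_ge0 : 0 <= e.

(** Every factor adds [2 ^ d.+1 * e] to the error. All fibres over the remaining coordinates are
    treated at once, because the next integrand is formed from them. *)
Lemma partial_product_zero_one m (h : (m <= k)%N) M :
  is_partial_product Q B mu h M ->
  2 * (2 ^ d.+1)%:R * (m%:R * ((2 ^ d.+1)%:R * e)) < 1 ->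
  0 < M (partial_box m X) /\
  good M (fun a x => fibre Q (proj (~: below k m) x) a)
    (m%:R * ((2 ^ d.+1)%:R * e)) (partial_box m X).
Proof.
elim: m h M => [|m IHm] h M.
  move=> /= pM _.
  (* The empty product has one point, so each fibre is empty or everything and the error is 0. *)
  have boxT : partial_box 0 X = setT.
    by apply/seteqP; split=> a // _ i hi; exfalso; move: hi; rewrite inE ltn0.
  rewrite boxT; split; first by rewrite (fa_setT pM).
  have fieldT : set_field (@setT (set (subprod V (below k 0)))) by [].
  have pt (a b : subprod V (below k 0)) : a = b.
    by apply: functional_extensionality_dep => i;
      apply: functional_extensionality_dep => hi; exfalso; move: hi;
      rewrite inE ltn0.
  move=> x; rewrite !mul0r; have [Qx|Qx] := pselect
      (exists a, fibre Q (proj (~: below k 0) x) a).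
    right; rewrite (_ : _ `\` _ = set0) ?(fa_set0 fieldT pM)//.
    by rewrite -subset0 => a [_ na]; case: Qx => b Qb; apply: na; rewrite (pt a b).
  left; rewrite (_ : _ `&` _ = set0) ?(fa_set0 fieldT pM)//.
  by rewrite -subset0 => a [_ Qa]; apply: Qx; exists a.
move=> /= [M' pM' [pM Mrect Mint]]; set N := (2 ^ d.+1)%N => small.
set i := Ordinal h in Mrect Mint pM.
have pMfa' := partial_product_fa pM'.
have Ne0 : 0 <= N%:R * e by rewrite mulr_ge0.
have small' : 2 * N%:R * (m%:R * (N%:R * e)) < 1.
  apply: le_lt_trans small; apply: ler_wpM2l; first by rewrite mulr_ge0.
  by apply: ler_wpM2r => //; rewrite ler_nat.
have [A0 gA] := IHm _ _ pM' small'.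
have FA := prod_field_box (ltnW h) BX.
have fieldM' := prod_field_set_field (ltnW h).
rewrite (partial_boxS h) -/i Mrect//; split; first exact: mulr_gt0.
move=> x.
(* With the coordinates of [x] above [i] fixed, [Q] becomes a binary relation between the previous
   partial product and the new factor. *)
pose r (a : subprod V (below k i)) (y : V i) := Q (glue a (dfwith x i y)).
have rE y : [set a | r a y] = fibre Q (proj (~: below k m) (dfwith x i y)).
  by rewrite [RHS]fibreE.
have rE1 a : r a = fibre1 Q (proj (~: [set i]%SET) (glue a x)).
  by rewrite fibre1E; apply/seteqP; split=> y /=; rewrite /r glue_dfwith.
have Fr := prod_field_fibre h (proj (~: below k m.+1) x).
have DE : definable Q (fibre Q (proj (~: below k m.+1) x)).
  by apply: sub_gen_smallest; exists (proj (~: below k m.+1) x).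
have := Mint _ (partial_box m X) (@X i) DE FA (@BX i).
rewrite (_ : (fun y => _) =
    (fun y => M' (partial_box m X `&` [set a | r a y]) * \1_(@X i) y)); last first.
  by apply/funext => y; rewrite (@section_fibre k V Q i) rE.
move=> intf.
have sectT y : prod_field Q B (ltnW h) [set a | r a y].
  by rewrite rE; exact: prod_field_fibre.
have sectU a : @B i (r a) by rewrite rE1; exact: fibre1B.
have gB : good (@mu i) (fun y a => r a y) e (@X i).
  by move=> a; have := goodX (proj (~: [set i]%SET) (glue a x)); rewrite -rE1.
have gA' : good M' r (m%:R * (N%:R * e)) (partial_box m X).
  by move=> y; have := gA (dfwith x i y); rewrite -rE.
have g0 : 0 <= m%:R * (N%:R * e) by rewrite mulr_ge0.
have := integral_zero_one fieldM' (fieldB i) pMfa' (probB i) sectT sectU FA (@BX i)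
  A0 gA' gB e_ge0 g0 small' (@stable_no_tree_glue k V Q d i x stableQ) intf.
rewrite -/N => /= zero_one.
have gS : m.+1%:R * (N%:R * e) = m%:R * (N%:R * e) + N%:R * e.
  by rewrite -natr1 mulrDl mul1r.
set F := fibre Q _; set A := rectangle _ _ _.
have FldA : prod_field Q B h A.
  by rewrite /A -(partial_boxS h); exact: prod_field_box.
have := fa_split (prod_field_set_field h) pM FldA Fr.
rewrite -/F {1}/A Mrect// (setIC A) => split_A.
by rewrite gS; case: zero_one => ?; [left | right]; lra.
Qed.

(** After all factors no coordinate remains, so the fibre over any [x0] is [Q] itself. Sub-boxes [Y]
    follow by monotonicity of the measure. *)
Lemma product_zero_one (x0 : forall i, V i) (M : set (forall i, V i) -> R) :
  is_product Q B mu M ->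
  2 * (2 ^ d.+1)%:R * (k%:R * ((2 ^ d.+1)%:R * e)) < 1 ->
  let g := k%:R * ((2 ^ d.+1)%:R * e) in
  0 < M (box X) /\
  ((forall Y : (forall i, set (V i)), (forall i, @B i (Y i)) ->
      (forall i, Y i `<=` @X i) -> M (Q `&` box Y) <= g * M (box X)) \/
   (forall Y : (forall i, set (V i)), (forall i, @B i (Y i)) ->
      (forall i, Y i `<=` @X i) ->
      M (box Y) - M (Q `&` box Y) <= g * M (box X))).
Proof.
move=> prodM small g.
pose M' (A : set (subprod V (below k k))) := M (proj (below k k) @^-1` A).
have [X0 /(_ x0) goodM] := @partial_product_zero_one k (leqnn k) M' prodM small.
have fld := prod_field_set_field (leqnn k).
have pM : fa_probability (prod_field Q B (leqnn k)) M' := partial_product_fa prodM.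
have inb i : i \in below k k by rewrite inE ltn_ord.
have boxE Y : M (box Y) = M' (partial_box k Y).
  congr M; apply/seteqP; split=> x /= Yx i; first by move=> hi; exact: Yx.
  exact: (Yx i (inb i)).
set F := fibre Q _ in goodM.
have FF : prod_field Q B (leqnn k) F by exact: prod_field_fibre.
have FE x : F (proj (below k k) x) <-> Q x.
  rewrite /F fibreE /= (_ : glue _ _ = x)//.
  by apply/esym/glue_eq => //; apply/proj_eq => i; rewrite inE inb.
have QboxE Y : M (Q `&` box Y) = M' (partial_box k Y `&` F).
  congr M; apply/seteqP; split=> x /=.
    by move=> [/FE Qx Yx]; split=> // i hi; exact: Yx.
  by move=> [Yx /FE Qx]; split=> // i; exact: (Yx i (inb i)).
have mono (Y : forall i, set (V i)) : (forall i, Y i `<=` @X i) ->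
    partial_box k Y `<=` partial_box k X.
  by move=> YX a Ya i hi; apply: YX.
rewrite boxE; split=> //; case: goodM => HM; [left | right] => Y BY YX.
  rewrite QboxE; apply: le_trans HM; apply: (fa_mono fld pM).
  - by apply: set_fieldI => //; exact: prod_field_box.
  - by apply: set_fieldI => //; exact: prod_field_box.
  - exact: setSI (mono Y YX).
rewrite QboxE boxE (fa_split fld pM (prod_field_box _ BY) FF) addrC addKr.
apply: le_trans HM; apply: (fa_mono fld pM).
- by apply: set_fieldD => //; exact: prod_field_box.
- by apply: set_fieldD => //; exact: prod_field_box.
- exact: setSD (mono Y YX).
Qed.

End Product.

(** * The regular partition *)

Lemma fa_probability_sub (R : realType) (T : Type) (F G : set (set T))
    (m : set T -> R) :
  F `<=` G -> fa_probability G m -> fa_probability F m.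
Proof.
by move=> FG [m0 mT mU]; split=> // [A /FG|A C /FG GA /FG GC]; [exact: m0 | exact: mU].
Qed.

Theorem mainTheorem6 (R : realType) (d k : nat) (hk : (0 < k)%N) :
  exists p : {poly R}, size p = d.+2 /\
    forall (V : 'I_k -> Type) (Q : set (forall i, V i))
      (B : forall i, set (set (V i))) (mu : forall i, set (V i) -> R)
      (M : set (forall i, V i) -> R) (eps : R),
      stable Q d ->
      (forall i, set_field (B i)) ->
      (forall i b, B i (fibre1 Q b)) ->
      (forall i, fa_probability (B i) (mu i)) ->
      is_product Q B mu M ->
      0 < eps -> eps < 1 / 2 ^+ d ->
      exists P : forall i, set (set (V i)),
        [/\ rect_partition P,
            rect_definable Q P,
            forall X : (forall i, set (V i)), (forall i, P i (X i)) ->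
              (forall Y : (forall i, set (V i)),
                 (forall i, B i (Y i)) -> (forall i, Y i `<=` X i) ->
                 M (box Y) - M (Q `&` box Y) < eps * M (box X))
              \/
              (forall Y : (forall i, set (V i)),
                 (forall i, B i (Y i)) -> (forall i, Y i `<=` X i) ->
                 M (Q `&` box Y) < eps * M (box X))
          & (rect_norm P)%:R <= p.[eps^-1]].
Proof.
set N := (2 ^ d.+1)%N.
have N1 : 1 <= N%:R :> R by rewrite ler1n expn_gt0.
have k1 : 1 <= k%:R :> R by rewrite ler1n.
(* With [e = eps / C] and sides that are [2 * e]-good, the smallness condition reads [eps / 2 < 1]
   and the final error is [eps / (4 * N)]. *)
pose C : R := 8 * k%:R * N%:R * N%:R.
have kNN1 : 1 <= k%:R * N%:R * N%:R :> R by rewrite !mulr_ege1.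
have C1 : 1 <= C by rewrite /C -!(mulrA 8); lra.
pose c : R := (4 * d.+1).+1%:R * C ^+ d.+1.
exists (c *: 'X^(d.+1)); split.
  by rewrite size_scale ?size_polyXn// mulf_neq0// ?pnatr_eq0// expf_neq0//; lra.
move=> V Q B mu M eps stableQ fieldB fibre1B probB prodM eps0 eps_small.
have eps1 : eps <= 1.
  apply: le_trans (ltW eps_small) _; rewrite div1r invf_le1 ?exprn_gt0//.
  by rewrite exprn_ege1// ler1n.
pose e := eps / C.
have C0 : 0 < C by lra.
have e0 : 0 < e by rewrite divr_gt0.
have e1 : e <= 1 by rewrite ler_pdivrMr// mul1r; lra.
(* Each factor is nonempty because its total measure is 1. *)
have x0 i : V i.
  exact: (projT1 (cid (fa_nonempty (fieldB i) (probB i) (A := setT)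
    ltac:(by rewrite (fa_setT (probB i)))))).
have defB i : @definable1 k V Q i `<=` B i.
  by apply: smallest_sub => // _ [b _ <-]; exact: fibre1B.
(* Working in the field generated by the fibres, with the measure restricted to it, makes the parts
   definable. *)
have partitions i := good_partition (gen_field_set_field _)
  (fa_probability_sub (@defB i) (probB i))
  (fun b => sub_gen_smallest (G := range (@fibre1 k V Q i)) (ex_intro2 _ _ b I erefl)) e0 e1
  (@stable_no_tree1 k V Q d i x0 stableQ).
pose P i := projT1 (cid (partitions i)).
have PP i := projT2 (cid (partitions i)).
exists P; split.
- by move=> i; have [] := PP i.
- by move=> i A PA; have [_ _ /(_ A PA)[]] := PP i.
- move=> X PX.
  have good_cell i : [/\ @definable1 k V Q i (X i),
      good (mu i) (fun y b => fibre1 Q b y) (2 * e) (X i) & 0 < mu i (X i)].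
    by have [_ _ + _] := PP i; apply; exact: PX.
  have BX i : B i (X i) by apply: defB; have [] := good_cell i.
  have X0 i : 0 < mu i (X i) by have [] := good_cell i.
  have gX i : good (mu i) (fun y b => fibre1 Q b y) (2 * e) (X i).
    by have [] := good_cell i.
  have Ce : 8 * k%:R * N%:R * N%:R * e = eps by rewrite mulrC divfK// gt_eqF.
  have small : 2 * N%:R * (k%:R * (N%:R * (2 * e))) < 1 by lra.
  have kNe : k%:R * (N%:R * (2 * e)) < eps.
    have kNe0 : 0 < k%:R * N%:R * e by rewrite mulr_gt0// mulr_gt0 ?(lt_le_trans ltr01).
    have : 0 <= k%:R * N%:R * e * (N%:R - 1) by apply: mulr_ge0; lra.
    by lra.
  have e20 : 0 <= 2 * e by rewrite mulr_ge0// ltW.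
  have [MX cases] := product_zero_one fieldB fibre1B probB stableQ BX X0 gX e20
    x0 prodM small.
  (* Strictness comes from the positive measure of every cell. *)
  have strict : k%:R * (N%:R * (2 * e)) * M (box X) < eps * M (box X).
    by rewrite ltr_pM2r.
  by case: cases => H; [right | left] => Y BY YX; apply: le_lt_trans strict; exact: H.
- have -> : (c *: 'X^(d.+1)).[eps^-1] = (4 * d.+1).+1%:R * e^-1 ^+ d.+1.
    by rewrite hornerZ hornerXn /c /e invf_div [in RHS]exprMn mulrA.
  rewrite /rect_norm; apply: (big_ind (fun n => n%:R <= _)) => [|a b ? ?|i _].
  + by rewrite mulr_ge0// exprn_ge0// invr_ge0 ltW.
  + by rewrite /maxn; case: ifP.
  + by have [] := PP i.
Qed.
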